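(* (i) $\mathrm{true}$-conditional bisimilarity implies $\mathrm{id}$-congruence: ${\simeq_T}\subseteq{\sim_{\mathrm{id}}}$. (ii) The converse fails in general: there exist a category $\mathbf C$ with distinguished object $0$, a representative class of squares $\kappa$, a conditional reactive system $\mathcal S$ and arrows $a,b\colon0\to J$ with $(a,b)\in{\sim_{\mathrm{id}}}$ but $(a,b)\notin{\simeq_T}$.
   Context: Composition of $f\colon A\to B$, $g\colon B\to C$ is written $f;g$. Fix a category $\mathbf C$ with distinguished object $0$ and a representative class $\kappa$ of commuting squares: for every commuting square $\alpha_1;\delta_1=\alpha_2;\delta_2$ there are $(\alpha_1,\alpha_2,\beta_1,\beta_2)\in\kappa$ (a commuting square) and $\gamma$ with $\delta_1=\beta_1;\gamma$, $\delta_2=\beta_2;\gamma$; $\kappa(\alpha_1,\alpha_2)$ is the set of $(\beta_1,\beta_2)$ with $(\alpha_1,\alpha_2,\beta_1,\beta_2)\in\kappa$. Conditions over $A$ are defined inductively as $(A,\mathcal Q,S)$, $\mathcal Q\in\{\forall,\exists\}$, $S$ a finite set of pairs $(h,\mathcal A')$ with $h\colon A\to A'$, $\mathcal A'$ a condition over $A'$; $\mathrm{true}_A=(A,\forall,\emptyset)$. For $a\colon A\to B$: $a\models(A,\forall,S)$ iff for all $(h,\mathcal A')\in S$ and all $g$ with $a=h;g$, $g\models\mathcal A'$; $a\models(A,\exists,S)$ iff some $(h,\mathcal A')\in S$ and $g$ satisfy $a=h;g$, $g\models\mathcal A'$. $\mathcal A\models\mathcal B$: every arrow satisfying $\mathcal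 A$ satisfies $\mathcal B$. Boolean connectives have the standard semantics. Shift along $c\colon A\to B$: $(A,\mathcal Q,S)_{\downarrow c}=(B,\mathcal Q,\{(\beta,\mathcal A'_{\downarrow\alpha})\mid(h,\mathcal A')\in S,(\alpha,\beta)\in\kappa(h,c)\})$; it satisfies $c;d\models\mathcal A\iff d\models\mathcal A_{\downarrow c}$. A conditional reactive system is a set $\mathcal S$ of rules $(\ell,r,\mathcal R)$, $\ell,r\colon0\to I$, $\mathcal R$ a condition over $I$. Reaction: $a\leadsto a'$ iff there are a rule and $c$ with $a=\ell;c$, $a'=r;c$, $c\models\mathcal R$. ${\sim_{\mathrm{id}}}$ is the set of pairs $(a,b)$, $a,b\colon0\to J$, such that for every arrow $d$ with domain $J$, $a;d$ and $b;d$ are bisimilar with respect to the unlabelled transition relation $\leadsto$. Context step $a\xrightarrow[C]{f,\ \mathcal A}a'$ ($a\colon0\to J$, $f\colon J\to K$, $a'\colon0\to K$, $\mathcal A$ over $K$): there are a rule $(\ell,r,\mathcal R)\in\mathcal S$ and $c\colon I\to K$ with $a;f=\ell;c$, $a'=r;c$, $\mathcal A\models\mathcal R_{\downarrow c}$. $\mathcal D\models\bigvee_{i\in I}\mathcal E_i$ (possibly infinite $I$): every arrow satisfying $\mathcal D$ satisfies some $\mathcal E_i$. A conditional relation is a set of triples $(a,b,\mathcal C)$, $a,b\colon0\to J$, $\mathcal C$ a condition over $J$. A conditional bisimulation is a conditional relation $R$ such that for each $(a,b,\mathcal C)\in R$ and each context step $a\xrightarrow[C]{f,\ \mathcal A}a'$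 there are a (possibly infinite) index set $I$, context steps $b\xrightarrow[C]{f,\ \mathcal B_i}b'_i$ and conditions $\mathcal C'_i$ with $(a',b'_i,\mathcal C'_i)\in R$ and $\mathcal A\land\mathcal C_{\downarrow f}\models\bigvee_{i\in I}(\mathcal C'_i\land\mathcal B_i)$, and symmetrically for context steps of $b$; $\simeq_C$ is the set of triples in some conditional bisimulation, and ${\simeq_T}=\{(a,b)\mid a,b\colon0\to J,\ (a,b,\mathrm{true}_J)\in{\simeq_C}\}$. *)

(* Defs.v *)
From Stdlib Require Import List.
Import ListNotations.

Set Implicit Arguments.
Unset Strict Implicit.
Unset Printing Implicit Defensive.

(** ** Categories, with composition in diagrammatic order *)

Record category : Type := Category {
  obj :> Type;
  hom : obj -> obj -> Type;
  idm : forall A : obj, hom A A;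
  comp : forall A B C : obj, hom A B -> hom B C -> hom A C;
  comp_idl : forall (A B : obj) (f : hom A B), comp (idm A) f = f;
  comp_idr : forall (A B : obj) (f : hom A B), comp f (idm B) = f;
  comp_assoc : forall (A B C D : obj) (f : hom A B) (g : hom B C) (h : hom C D),
    comp (comp f g) h = comp f (comp g h)
}.

Arguments idm {c} A.

Notation "f ;; g" := (comp f g) (at level 40, left associativity).

Record cospan (C : category) (B1 B2 : C) : Type := Cospan {
  apex : C;
  leg1 : hom B1 apex;
  leg2 : hom B2 apex
}.

(** ** Representative classes of squares

    [kappa α1 α2] lists the pairs [(β1, β2)] such that [(α1, α2, β1, β2)] is a
    representative square.  The list makes each of these sets finite, which is
    what the shift of a (finitely branching) condition needs in order to be a
    condition again; order and repetitions in the list are immaterial. *)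

Record repr_squares (C : category) : Type := ReprSquares {
  kappa : forall A B1 B2 : C, hom A B1 -> hom A B2 -> list (cospan B1 B2);
  kappa_commutes : forall (A B1 B2 : C) (α1 : hom A B1) (α2 : hom A B2)
      (s : cospan B1 B2),
    In s (kappa α1 α2) -> α1 ;; leg1 s = α2 ;; leg2 s;
  kappa_repr : forall (A B1 B2 D : C) (α1 : hom A B1) (α2 : hom A B2)
      (δ1 : hom B1 D) (δ2 : hom B2 D),
    α1 ;; δ1 = α2 ;; δ2 ->
    exists (s : cospan B1 B2) (γ : hom (apex s) D),
      In s (kappa α1 α2) /\ δ1 = leg1 s ;; γ /\ δ2 = leg2 s ;; γ
}.

(** ** Conditions *)

Inductive quantifier : Type := All | Ex.

(* The finite set of pairs [(h, A')] is represented by a list. *)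
Inductive cond (C : category) (A : C) : Type :=
  Cond : quantifier -> list {A' : C & (hom A A' * cond A')%type} -> cond A.

Definition true_cond (C : category) (A : C) : cond A := Cond All [].

(* The conjunction (disjunction) over the list of children is written with
   [fold_right] so that the recursion is structural; [sat_All] and [sat_Ex]
   below restate it in terms of membership. *)
Fixpoint sat (C : category) (A : C) (c : cond A) {struct c} :
    forall B : C, hom A B -> Prop :=
  fun B a =>
  match c with
  | Cond All l =>
      fold_right and True
        (map (fun p => let '(existT _ A' (h, c')) := p in
                       forall g : hom A' B, a = h ;; g -> sat c' g) l)
  | Cond Ex l =>
      fold_right or False
        (map (fun p => let '(existT _ A' (h, c')) := p in
                       exists g : hom A' B, a = h ;; g /\ sat c' g) l)
  end.

Lemma sat_All (C : category) (A B : C)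
    (l : list {A' : C & (hom A A' * cond A')%type}) (a : hom A B) :
  sat (Cond All l) a <->
  forall (A' : C) (h : hom A A') (c' : cond A'), In (existT _ A' (h, c')) l ->
    forall g : hom A' B, a = h ;; g -> sat c' g.
Proof.
simpl; induction l as [|[X [k d]] l IH]; simpl; split; try easy.
- intros [H1 H2] A' h c' [E | H].
  + change (let '(existT _ A'0 (h0, c'0)) := existT _ A' (h, c') in
            forall g : hom A'0 B, a = h0 ;; g -> sat c'0 g).
    rewrite <- E; exact H1.
  + exact (proj1 IH H2 A' h c' H).
- intros H; split.
  + apply H; left; reflexivity.
  + apply IH; intros A' h c' Hin; apply H; right; exact Hin.
Qed.

Lemma sat_Ex (C : category) (A B : C)
    (l : list {A' : C & (hom A A' * cond A')%type}) (a : hom A B) :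
  sat (Cond Ex l) a <->
  exists (A' : C) (h : hom A A') (c' : cond A') (g : hom A' B),
    In (existT _ A' (h, c')) l /\ a = h ;; g /\ sat c' g.
Proof.
simpl; induction l as [|[X [k d]] l IH]; simpl; split; try easy.
- intros (A' & h & c' & g & [] & _).
- intros [(g & E & H) | H].
  + exists X, k, d, g; auto.
  + destruct (proj1 IH H) as (A' & h & c' & g & Hin & E & Hs).
    exists A', h, c', g; auto.
- intros (A' & h & c' & g & [E | Hin] & Ea & Hs).
  + left.
    change (let '(existT _ A'0 (h0, c'0)) := existT (fun A'0 : C =>
              (hom A A'0 * cond A'0)%type) X (k, d) in
            exists g0 : hom A'0 B, a = h0 ;; g0 /\ sat c'0 g0).
    rewrite E; exists g; auto.
  + right; apply IH; exists A', h, c', g; auto.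
Qed.

Definition entails (C : category) (A : C) (c d : cond A) : Prop :=
  forall (B : C) (x : hom A B), sat c x -> sat d x.

Fixpoint shift (C : category) (κ : repr_squares C) (A : C) (a : cond A)
    {struct a} : forall B : C, hom A B -> cond B :=
  fun B c =>
  match a with
  | Cond q l =>
      Cond q (flat_map
        (fun p => let '(existT _ A' (h, a')) := p in
           map (fun s => existT _ (apex s) (leg2 s, shift κ a' (leg1 s)))
               (kappa κ h c)) l)
  end.

(** ** Conditional reactive systems *)

Record rule (C : category) (O : C) : Type := Rule {
  interface : C;
  lhs : hom O interface;
  rhs : hom O interface;
  rcond : cond interface
}.

(* A possibly infinite set of rules. *)
Definition reactive_system (C : category) (O : C) : Type := rule O -> Prop.

Definition reaction (C : category) (O : C) (S : reactive_system O) (J : C)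
    (a a' : hom O J) : Prop :=
  exists (ρ : rule O) (c : hom (interface ρ) J),
    S ρ /\ a = lhs ρ ;; c /\ a' = rhs ρ ;; c /\ sat (rcond ρ) c.

Definition bisimulation (X : Type) (step R : X -> X -> Prop) : Prop :=
  forall x y, R x y ->
    (forall x', step x x' -> exists y', step y y' /\ R x' y') /\
    (forall y', step y y' -> exists x', step x x' /\ R x' y').

Definition bisimilar (X : Type) (step : X -> X -> Prop) (x y : X) : Prop :=
  exists R : X -> X -> Prop, bisimulation step R /\ R x y.

(* Reactions preserve the codomain, so [a ;; d] and [b ;; d] can be compared in
   the transition system on [hom O K]. *)
Definition id_congruence (C : category) (O : C) (S : reactive_system O) (J : C)
    (a b : hom O J) : Prop :=
  forall (K : C) (d : hom J K), bisimilar (@reaction C O S K) (a ;; d) (b ;; d).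

(** ** Conditional bisimilarity *)

(* [context_step κ S a f A a'] is the context step from [a] to [a'] labelled
   with the borrowed context [f] and the condition [A]. *)
Definition context_step (C : category) (O : C) (κ : repr_squares C)
    (S : reactive_system O) (J K : C) (a : hom O J) (f : hom J K) (A : cond K)
    (a' : hom O K) : Prop :=
  exists (ρ : rule O) (c : hom (interface ρ) K),
    S ρ /\ a ;; f = lhs ρ ;; c /\ a' = rhs ρ ;; c /\
    entails A (shift κ (rcond ρ) c).

Definition cond_relation (C : category) (O : C) : Type :=
  forall J : C, hom O J -> hom O J -> cond J -> Prop.

Definition cond_bisimulation (C : category) (O : C) (κ : repr_squares C)
    (S : reactive_system O) (R : cond_relation O) : Prop :=
  forall (J : C) (a b : hom O J) (D : cond J), R J a b D ->
    (forall (K : C) (f : hom J K) (A : cond K) (a' : hom O K),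
       context_step κ S a f A a' ->
       exists (I : Type) (B : I -> cond K) (b' : I -> hom O K)
              (D' : I -> cond K),
         (forall i, context_step κ S b f (B i) (b' i) /\ R K a' (b' i) (D' i)) /\
         (forall (L : C) (x : hom K L), sat A x /\ sat (shift κ D f) x ->
            exists i, sat (D' i) x /\ sat (B i) x)) /\
    (forall (K : C) (f : hom J K) (B : cond K) (b' : hom O K),
       context_step κ S b f B b' ->
       exists (I : Type) (A : I -> cond K) (a' : I -> hom O K)
              (D' : I -> cond K),
         (forall i, context_step κ S a f (A i) (a' i) /\ R K (a' i) b' (D' i)) /\
         (forall (L : C) (x : hom K L), sat B x /\ sat (shift κ D f) x ->
            exists i, sat (D' i) x /\ sat (A i) x)).

Definition cond_bisimilar (C : category) (O : C) (κ : repr_squares C)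
    (S : reactive_system O) (J : C) (a b : hom O J) (D : cond J) : Prop :=
  exists R : cond_relation O, cond_bisimulation κ S R /\ R J a b D.

Definition true_cond_bisimilar (C : category) (O : C) (κ : repr_squares C)
    (S : reactive_system O) (J : C) (a b : hom O J) : Prop :=
  cond_bisimilar κ S a b (true_cond J).

(* Main.v *)
(** (i) If [R] is a conditional bisimulation, then the pairs [(a ;; d, b ;; d)]
    with [R a b D] and [d] satisfying [D] form a bisimulation: a reaction of
    [a ;; d] is a context step of [a] with borrowed context [d], and the
    entailment that the answer satisfies is evaluated at the identity.

    (ii) Conditions are finite, so they cannot exclude infinitely many contexts
    at once.  Take contexts [id] and [x_n] (one for each natural number [n]) and
    states [a], [b], [N], [P].  In context [id] let [a -> N] and [b -> P]; in
    every context [x_n] let both [a] and [b] react to [N] and to [P], and [P]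
    react to [N].  Then [a] and [b] are bisimilar in each fixed context.  But in
    context [id] the step [a -> N] must be answered by [b -> P], and any
    condition satisfied by [id] is also satisfied by [x_n] for all large [n],
    where [P] reacts and [N] does not. *)

From Stdlib Require Import List Arith Lia.
Require Import Defs.
Import ListNotations.

Set Implicit Arguments.
Unset Strict Implicit.
Unset Printing Implicit Defensive.

(** * Induction on conditions and satisfaction of shifts *)

Section NestedInduction.

Variables (C : category) (Pr : forall A : C, cond A -> Prop).

Hypothesis step : forall (A : C) q l,
  (forall (A' : C) (h : hom A A') (c' : cond A'),
     In (existT _ A' (h, c')) l -> Pr c') ->
  Pr (Cond (A := A) q l).

(** Subconditions sit inside a list, so the recursion on the condition wraps an induction on that
    list. *)
Fixpoint cond_nested_ind (A : C) (c : cond A) {struct c} : Pr c.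
Proof.
destruct c as [q l]; apply step.
induction l as [|[X [k d]] l IH]; simpl; intros A' h c' Hin.
- destruct Hin.
- destruct Hin as [E | Hin].
  (* [E] equates dependent pairs; rewriting the whole pair under a projection avoids injectivity of
     [existT]. *)
  + change (Pr (snd (projT2 (existT (fun A' : C => (hom A A' * cond A')%type)
                               A' (h, c'))))).
    rewrite <- E; apply cond_nested_ind.
  + exact (IH A' h c' Hin).
Defined.

End NestedInduction.

Lemma in_shift_children (C : category) (κ : repr_squares C) (A B : C) (c : hom A B)
    (l : list {A' : C & (hom A A' * cond A')%type})
    (p : {B' : C & (hom B B' * cond B')%type}) :
  In p (flat_map
          (fun p => let '(existT _ A' (h, a')) := p in
             map (fun s => existT _ (apex s) (leg2 s, shift κ a' (leg1 s)))
                 (kappa κ h c)) l) <->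
  exists (A' : C) (h : hom A A') (a' : cond A') s,
    In (existT _ A' (h, a')) l /\ In s (kappa κ h c) /\
    p = existT _ (apex s) (leg2 s, shift κ a' (leg1 s)).
Proof.
rewrite in_flat_map; split.
- intros ([A' [h a']] & Hl & Hp).
  apply in_map_iff in Hp; destruct Hp as (s & <- & Hs).
  exists A', h, a', s; auto.
- intros (A' & h & a' & s & Hl & Hs & ->).
  exists (existT _ A' (h, a')); split; [exact Hl|].
  apply in_map_iff; exists s; auto.
Qed.

(** Representativity turns a factorisation of [c ;; d] through [h] into one of [d] through a leg of
    a square in [kappa κ h c]; commutation of the square gives the converse. *)
Lemma sat_shift (C : category) (κ : repr_squares C) (A : C) (a : cond A) :
  forall (B D : C) (c : hom A B) (d : hom B D),
    sat (shift κ a c) d <-> sat a (c ;; d).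
Proof.
induction a as [A [] l IH] using cond_nested_ind; intros B D c d;
  cbn [shift]; [rewrite !sat_All | rewrite !sat_Ex].
- split.
  + intros H A' h a' Hl g Eg.
    destruct (kappa_repr κ (eq_sym Eg)) as (s & γ & Hs & -> & ->).
    apply (IH _ _ _ Hl), (H _ (leg2 s)); [|reflexivity].
    apply in_shift_children; exists A', h, a', s; auto.
  + intros H B' k c' Hp.
    apply in_shift_children in Hp; destruct Hp as (A' & h & a' & s & Hl & Hs & E).
    change (let '(existT _ X (k, c')) := existT (fun B' : C =>
              (hom B B' * cond B')%type) B' (k, c') in
            forall g : hom X D, d = k ;; g -> sat c' g).
    rewrite E; intros g ->.
    apply (IH _ _ _ Hl), (H _ _ _ Hl).
    rewrite <- !comp_assoc, (kappa_commutes Hs); reflexivity.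
- split.
  + intros (B' & k & c' & g & Hp & Eg & Hg).
    apply in_shift_children in Hp; destruct Hp as (A' & h & a' & s & Hl & Hs & E).
    assert (Hex : let '(existT _ X (k, c')) := existT (fun B' : C =>
              (hom B B' * cond B')%type) B' (k, c') in
            exists g : hom X D, d = k ;; g /\ sat c' g) by (exists g; auto).
    rewrite E in Hex; destruct Hex as (g' & -> & Hg').
    exists A', h, a', (leg1 s ;; g'); split; [exact Hl|split].
    * rewrite <- !comp_assoc, (kappa_commutes Hs); reflexivity.
    * apply (IH _ _ _ Hl); exact Hg'.
  + intros (A' & h & a' & g & Hl & Eg & Hg).
    destruct (kappa_repr κ (eq_sym Eg)) as (s & γ & Hs & -> & ->).
    exists (apex s), (leg2 s), (shift κ a' (leg1 s)), γ.
    split; [apply in_shift_children; exists A', h, a', s; auto|split].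
    * reflexivity.
    * apply (IH _ _ _ Hl); exact Hg.
Qed.

(** * Evaluation at the identity: from conditional to plain bisimilarity *)

Lemma sat_shift_id (C : category) (κ : repr_squares C) (A B : C) (a : cond A)
    (c : hom A B) : sat (shift κ a c) (idm B) <-> sat a c.
Proof. rewrite sat_shift, comp_idr; reflexivity. Qed.

(** The rule condition shifted along [c] is the weakest admissible label, and it holds at the
    identity exactly when [c] satisfies the rule condition. *)
Lemma reaction_context_step (C : category) (O : C) (κ : repr_squares C)
    (S : reactive_system O) (J K : C) (a : hom O J) (d : hom J K) (a' : hom O K) :
  reaction S (a ;; d) a' <->
  exists A : cond K, context_step κ S a d A a' /\ sat A (idm K).
Proof.
split.
- intros (ρ & c & Hρ & E & E' & Hc).
  exists (shift κ (rcond ρ) c); split.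
  + exists ρ, c; repeat split; auto; intros L x Hx; exact Hx.
  + apply sat_shift_id; exact Hc.
- intros (A & (ρ & c & Hρ & E & E' & Hent) & HA).
  exists ρ, c; repeat split; auto.
  apply (sat_shift_id κ), Hent, HA.
Qed.

(** The generality in [D] serves twice: [true_cond] yields (i), while (ii) takes the condition under
    which [sN] and [sP] are related. *)
Lemma cond_bisimilar_context (C : category) (O : C) (κ : repr_squares C)
    (S : reactive_system O) (J K : C) (a b : hom O J) (D : cond J) (d : hom J K) :
  cond_bisimilar κ S a b D -> sat D d ->
  bisimilar (@reaction C O S K) (a ;; d) (b ;; d).
Proof.
intros (R & HR & Hab) Hd.
exists (fun x y => exists (J : C) (a b : hom O J) (D : cond J) (d : hom J K),
          R J a b D /\ sat D d /\ x = a ;; d /\ y = b ;; d).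
split; [|exists J, a, b, D, d; auto].
clear J a b D d Hab Hd.
intros x y (J & a & b & D & d & Hab & Hd & -> & ->).
destruct (HR _ _ _ _ Hab) as [Hl Hr]; split; intros z Hz;
  apply (reaction_context_step κ) in Hz; destruct Hz as (A & Hz & HA);
  [destruct (Hl _ _ _ _ Hz) as (I & B & w & D' & HI & Hcover)
  |destruct (Hr _ _ _ _ Hz) as (I & B & w & D' & HI & Hcover)];
  destruct (Hcover K (idm K)) as (i & HD' & HB);
  try (split; [exact HA | apply sat_shift_id; exact Hd]);
  destruct (HI i) as [Hw HRw]; exists (w i); split.
- apply (reaction_context_step κ); exists (B i); auto.
(* The successors have already absorbed [d], so their remaining context is the identity. *)
- exists K, z, (w i), (D' i), (idm K); rewrite !comp_idr; auto.
- apply (reaction_context_step κ); exists (B i); auto.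
- exists K, (w i), z, (D' i), (idm K); rewrite !comp_idr; auto.
Qed.

(** * A category with one context per natural number *)

Inductive object : Type := Source | Middle | Leaf (n : nat).

Inductive state : Type := sA | sB | sN | sP.

(* The non-identity arrows out of [Source] are states, unchanged by composition;
   the context [x_n] is the arrow from [Middle] to [Leaf n]. *)
Definition arrow (X Y : object) : Type :=
  match X, Y with
  | Source, Source => unit
  | Source, _ => state
  | Middle, Source => Empty_set
  | Middle, _ => unit
  | Leaf m, Leaf n => m = n
  | Leaf _, _ => Empty_set
  end.

Definition arrow_id (X : object) : arrow X X :=
  match X with
  | Source => tt
  | Middle => tt
  | Leaf n => eq_refl
  end.

Definition arrow_comp (X Y Z : object) : arrow X Y -> arrow Y Z -> arrow X Z.
Proof.
destruct X, Y, Z; simpl; intros f g; subst;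
  solve [exact f | exact g | exact tt | exact eq_refl | destruct f | destruct g].
Defined.

Ltac case_arrows :=
  repeat match goal with
  | f : arrow ?X ?Y |- _ => progress cbn in f
  | f : unit |- _ => destruct f
  | f : Empty_set |- _ => destruct f
  | f : ?m = ?n :> nat |- _ => is_var n; subst n
  | f : ?m = ?m :> nat |- _ => rewrite (Eqdep_dec.UIP_refl_nat m f) in *; clear f
  end.

Definition leaves : category.
Proof.
refine (@Category object arrow arrow_id arrow_comp _ _ _).
- intros [] [] f; case_arrows; reflexivity.
- intros [] [] f; case_arrows; reflexivity.
- intros [] [] [] [] f g h; case_arrows; reflexivity.
Defined.

Lemma arrow_eq_dec (X Y : object) (f g : arrow X Y) : {f = g} + {f <> g}.
Proof.
destruct X, Y; case_arrows; try (left; reflexivity); decide equality.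
Defined.

Definition arrows (X Y : object) : list (arrow X Y) :=
  match X, Y with
  | Source, Source => [tt]
  | Source, Middle | Source, Leaf _ => [sA; sB; sN; sP]
  | Middle, Source => []
  | Middle, Middle | Middle, Leaf _ => [tt]
  | Leaf m, Leaf n =>
      match Nat.eq_dec m n with left e => [e] | right _ => [] end
  | Leaf _, Source | Leaf _, Middle => []
  end.

Lemma in_arrows (X Y : object) (f : arrow X Y) : In f (arrows X Y).
Proof.
destruct X as [| |m], Y as [| |n]; cbn in *; case_arrows; auto;
  try (destruct f; tauto).
destruct (Nat.eq_dec _ _) as [e|]; [|congruence].
left; apply Eqdep_dec.UIP_refl_nat.
Qed.

(* When two arrows with the same domain complete to a commuting square, one of
   them factors through the other, so the squares with an identity leg are representative. *)
Definition leaves_squares : repr_squares leaves.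
Proof.
refine (@ReprSquares leaves
  (fun A B1 B2 α1 α2 =>
     map (fun β => @Cospan leaves B1 B2 B2 β (idm (c := leaves) B2))
       (filter (fun β => if arrow_eq_dec (arrow_comp α1 β) α2 then true else false)
          (arrows B1 B2)) ++
     map (fun β => @Cospan leaves B1 B2 B1 (idm (c := leaves) B1) β)
       (filter (fun β => if arrow_eq_dec α1 (arrow_comp α2 β) then true else false)
          (arrows B2 B1))) _ _).
- intros A B1 B2 α1 α2 s Hs.
  apply in_app_iff in Hs; destruct Hs as [Hs|Hs]; apply in_map_iff in Hs;
    destruct Hs as (β & <- & Hβ); apply filter_In in Hβ; destruct Hβ as [_ Hβ];
    cbn [leg1 leg2]; rewrite comp_idr.
  + destruct (arrow_eq_dec (arrow_comp α1 β) α2); [assumption|discriminate].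
  + destruct (arrow_eq_dec α1 (arrow_comp α2 β)); [assumption|discriminate].
- intros A B1 B2 D α1 α2 δ1 δ2 E.
  assert (Hcmp : (exists β : hom (c := leaves) B1 B2, α1 ;; β = α2 /\ δ1 = β ;; δ2) \/
                 (exists β : hom (c := leaves) B2 B1, α1 = α2 ;; β /\ δ2 = β ;; δ1)).
  { destruct A, B1, B2, D; cbn in *; case_arrows; cbn in *; subst.
    all: first [ left; eexists; split; reflexivity
               | right; eexists; split; reflexivity
               | left; exists eq_refl; split; reflexivity]. }
  destruct Hcmp as [(β & H1 & H2)|(β & H1 & H2)].
  + exists (@Cospan leaves B1 B2 B2 β (idm (c := leaves) B2)), δ2; cbn [apex leg1 leg2].
    rewrite comp_idl; repeat split; auto.
    apply in_app_iff; left; apply in_map_iff; exists β; split; [reflexivity|].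
    apply filter_In; split; [apply in_arrows|].
    destruct (arrow_eq_dec (arrow_comp α1 β) α2); [reflexivity|contradiction].
  + exists (@Cospan leaves B1 B2 B1 (idm (c := leaves) B1) β), δ1; cbn [apex leg1 leg2].
    rewrite comp_idl; repeat split; auto.
    apply in_app_iff; right; apply in_map_iff; exists β; split; [reflexivity|].
    apply filter_In; split; [apply in_arrows|].
    destruct (arrow_eq_dec α1 (arrow_comp α2 β)); [reflexivity|contradiction].
Defined.

(** * The rules and the reactions they generate *)

Inductive rules : reactive_system (C := leaves) Source :=
  | rule_AN : rules (@Rule leaves Source Middle sA sN (true_cond _))
  | rule_BP : rules (@Rule leaves Source Middle sB sP (true_cond _))
  | rule_AP n : rules (@Rule leaves Source (Leaf n) sA sP (true_cond _))
  | rule_BN n : rules (@Rule leaves Source (Leaf n) sB sN (true_cond _))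
  | rule_PN n : rules (@Rule leaves Source (Leaf n) sP sN (true_cond _)).

Lemma rules_react (ρ : rule (C := leaves) Source) :
  rules ρ -> forall (J : leaves) (c : hom (interface ρ) J),
  sat (rcond ρ) c -> reaction rules (lhs ρ ;; c) (rhs ρ ;; c).
Proof. intros Hρ J c Hc; exists ρ, c; auto. Qed.

(** No arrow leads from a leaf to [Middle], so only the two rules with interface [Middle] apply. *)
Lemma reaction_Middle (s t : state) :
  reaction (C := leaves) (J := Middle) rules s t <->
  s = sA /\ t = sN \/ s = sB /\ t = sP.
Proof.
split.
- intros (ρ & c & Hρ & E & E' & _); destruct Hρ; cbn in *; case_arrows; subst; auto.
- intros [[-> ->]|[-> ->]];
    [exact (rules_react rule_AN (J := Middle) (c := tt) I)
    |exact (rules_react rule_BP (J := Middle) (c := tt) I)].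
Qed.

Lemma reaction_Leaf (n : nat) (s t : state) :
  reaction (C := leaves) (J := Leaf n) rules s t <->
  (s = sA \/ s = sB) /\ (t = sN \/ t = sP) \/ s = sP /\ t = sN.
Proof.
split.
- intros (ρ & c & Hρ & E & E' & _); destruct Hρ; cbn in *; case_arrows; cbn in *;
    subst; auto.
- intros [[[->| ->] [->| ->]]|[-> ->]].
  + exact (rules_react rule_AN (J := Leaf n) (c := tt) I).
  + exact (rules_react (rule_AP n) (J := Leaf n) (c := eq_refl) I).
  + exact (rules_react (rule_BN n) (J := Leaf n) (c := eq_refl) I).
  + exact (rules_react rule_BP (J := Leaf n) (c := tt) I).
  + exact (rules_react (rule_PN n) (J := Leaf n) (c := eq_refl) I).
Qed.

(** * Separation of the two relations by [sA] and [sB] *)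

Lemma sA_sB_id_congruence : id_congruence (C := leaves) (J := Middle) rules sA sB.
Proof.
intros [| |n] d; [destruct d| |].
(* In [Middle] both [sN] and [sP] are stuck. *)
- exists (fun s t : state => s = sA /\ t = sB \/ s = sN /\ t = sP).
  split; [|left; split; reflexivity].
  intros s t [[-> ->]|[-> ->]]; split; intros u Hu; apply reaction_Middle in Hu;
    destruct Hu as [[E ->]|[E ->]]; try discriminate.
  + exists sP; split; [apply reaction_Middle|]; auto.
  + exists sN; split; [apply reaction_Middle|]; auto.
(* In a leaf [sA] and [sB] have the same successors, so equality suffices after one step. *)
- exists (fun s t : state => s = sA /\ t = sB \/ s = t).
  split; [|left; split; reflexivity].
  intros s t [[-> ->]| ->]; split; intros u Hu; exists u; split; auto;
    apply reaction_Leaf in Hu; apply reaction_Leaf;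
    destruct Hu as [[_ Hu]|[E _]]; try discriminate; auto.
Qed.

(** A child over [Middle] has a threshold by induction, a child over [Leaf k] matters only at [x_k],
    and finitely many children have a common threshold. The [match] lets the induction range over
    conditions on all objects. *)
Lemma cond_Middle_eventually_constant (X : leaves) (D : cond X) :
  match X return cond (C := leaves) X -> Prop with
  | Middle => fun D => exists m, forall n, m <= n ->
      (sat D (tt : hom (c := leaves) Middle Middle) <->
       sat D (tt : hom (c := leaves) Middle (Leaf n)))
  | _ => fun _ => True
  end D.
Proof.
revert X D; apply (cond_nested_ind (C := leaves)); intros X q l IH.
destruct X as [| |k]; try exact I.
induction l as [|[Y [h D]] l IHl].
- exists 0; intros n _; destruct q; cbn; tauto.
- destruct IHl as [m Hm]; [intros; eapply IH; right; eassumption|].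
  specialize (IH Y h D (or_introl eq_refl)).
  destruct Y as [| |k]; cbn in h; case_arrows.
  + destruct IH as [m' Hm'].
    exists (max m m'); intros n Hn.
    specialize (Hm n ltac:(lia)); specialize (Hm' n ltac:(lia)).
    destruct q; cbn in Hm |- *; rewrite Hm.
    * split; intros [H1 H2]; (split; [|exact H2]); intros [] _;
        apply Hm', H1; reflexivity.
    * split; (intros [(g & _ & Hg)|H]; [left; exists tt|right; exact H]);
        destruct g; split; try reflexivity; apply Hm', Hg.
  (* Neither the identity nor [x_n] with [n > k] factors through [Leaf k], so this child is vacuous
     for [All] and false for [Ex]. *)
  + exists (max m (S k)); intros n Hn.
    specialize (Hm n ltac:(lia)).
    destruct q; cbn in Hm |- *; rewrite Hm.
    * split; intros [_ H]; (split; [|exact H]); intros g; [exfalso; lia|destruct g].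
    * split; (intros [(g & _)|H]; [exfalso|right; exact H]); [destruct g|lia].
Qed.

Lemma sA_sB_not_true_cond_bisimilar (κ : repr_squares leaves) :
  ~ true_cond_bisimilar (C := leaves) (J := Middle) κ rules sA sB.
Proof.
intros (R & HR & Hab).
assert (Hstep : context_step (C := leaves) (J := Middle) κ rules sA
                  (idm (c := leaves) Middle) (true_cond (C := leaves) Middle) sN).
{ exists (@Rule leaves Source Middle sA sN (true_cond _)), (tt : arrow Middle Middle).
  split; [constructor|]; repeat split. }
destruct (HR _ _ _ _ Hab) as [Hl _].
destruct (Hl _ _ _ _ Hstep) as (Ix & B & t & D & HI & Hcover).
destruct (Hcover Middle (idm (c := leaves) Middle)) as (i & HD & HB).
{ split; exact I. }
destruct (HI i) as [Ht HNP].
(* A context step whose label holds at the identity is a reaction in [Middle], where [sB] reaches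
   only [sP]. *)
assert (Et : t i = sP).
{ assert (Hr : reaction (C := leaves) (J := Middle) rules sB (t i))
    by (apply (reaction_context_step (C := leaves) (J := Middle) κ rules sB
                 (idm (c := leaves) Middle)); exists (B i); auto).
  apply reaction_Middle in Hr; destruct Hr as [[E _]|[_ E]]; [discriminate|exact E]. }
rewrite Et in HNP.
destruct (cond_Middle_eventually_constant (X := Middle) (D i)) as [n Hn].
specialize (Hn n (le_n n)).
assert (Hbis := cond_bisimilar_context (C := leaves) (d := tt : arrow Middle (Leaf n))
                  (ex_intro _ R (conj HR HNP)) (proj1 Hn HD)).
destruct Hbis as (Q & HQ & HNP').
destruct (HQ _ _ HNP') as [_ Hr].
destruct (Hr sN) as (u & Hu & _).
{ apply reaction_Leaf; auto. }
apply reaction_Leaf in Hu; destruct Hu as [[[E|E] _]|[E _]]; discriminate.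
Qed.

Theorem theorem6p6 :
  (forall (C : category) (O : C) (κ : repr_squares C) (S : reactive_system O)
          (J : C) (a b : hom O J),
     true_cond_bisimilar κ S a b -> id_congruence S a b) /\
  (exists (C : category) (O : C) (κ : repr_squares C) (S : reactive_system O)
          (J : C) (a b : hom O J),
     id_congruence S a b /\ ~ true_cond_bisimilar κ S a b).
Proof.
split.
- intros C O κ S J a b H K d; exact (cond_bisimilar_context H (d := d) I).
- exists leaves, Source, leaves_squares, rules, Middle, sA, sB; split.
  + exact sA_sB_id_congruence.
  + apply sA_sB_not_true_cond_bisimilar.
Qed.
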